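(* Suppose $z\in\mathrm{FPF}_n(\mathcal{I}_n)$ and $Q\subseteq\{(i,j)\in[n]\times[n]:i>j\}$. Then $\Sigma(z,Q)$ is vertex-decomposable and therefore shellable.
   Context: $n$ is a positive integer, $[n]=\{1,\dots,n\}$, $\mathbb{N}=\{1,2,3,\dots\}$. $\mathcal{I}_n=\{w\in S_n:w^2=1\}$. For $y\in\mathcal{I}_n$ with fixed points $i_1<\dots<i_k$ in $[n]$, $\mathrm{FPF}_n(y)$ is the fixed-point-free involution of $\mathbb{N}$ given by $y\cdot(i_1,n+1)(i_2,n+2)\cdots(i_k,n+k)\cdot(n+k+1,n+k+2)(n+k+3,n+k+4)\cdots$. $\mathrm{FPF}_n(\mathcal{I}_n)$ is the image of this map. Pipe dreams: the reading word of a finite set $D\subset\mathbb{N}\times\mathbb{N}$ lists the numbers $i+j-1$ for $(i,j)\in D$ in the order making $(i,-j)$ increase lexicographically. $\mathcal{RP}(w)$, for a permutation $w$ of $\mathbb{N}$ with finite support, is the set of finite $D\subset\mathbb{N}\times\mathbb{N}$ whose reading word $i_1\cdots i_l$ is a reduced word for $w$ (i.e., $w=s_{i_1}\cdots s_{i_l}$ with $l$ minimal, $s_i=(i,i+1)$). Given $z\in\mathrm{FPF}_n(\mathcal{I}_n)$, choose an even $m$ and a fixed-point-free involution $y\in S_m$ with $z=y\cdot(m+1,m+2)(m+3,m+4)\cdots$; then $\mathcal{FP}(z):=\{D\cap\{(i,j)\in\mathbb{N}\times\mathbb{N}:i>j\}:D=D^T\in\mathcal{RP}(y)\}$, independent of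 the choice of $m,y$. $\Sigma(z,Q)$ is the simplicial complex with vertex set $Q$ and faces all $S\subseteq Q$ such that $Q\setminus S$ contains some element of $\mathcal{FP}(z)$ as a subset. A simplicial complex with vertex set $V$ is a (possibly empty) collection of subsets of $V$ closed under taking subsets; $\{v\}$ need not be a face for every $v\in V$. For $F\subseteq V$, $\mathrm{lk}_F\Delta=\{E\in\Delta:E\cap F=\emptyset,\ E\cup F\in\Delta\}$ and $\mathrm{del}_F\Delta=\{E\in\Delta:E\cap F=\emptyset\}$, both with vertex set $V\setminus F$. A complex is pure if all maximal faces have the same dimension. Vertex-decomposability is defined recursively: the complexes $\{\emptyset\}$ and $\emptyset$ are vertex-decomposable, and a complex $\Delta$ with nonempty vertex set $V$ is vertex-decomposable if it is pure and there is $v\in V$ (with $\{v\}$ not necessarily a face) such that $\mathrm{del}_{\{v\}}\Delta$ and $\mathrm{lk}_{\{v\}}\Delta$ are vertex-decomposable. Shellable means: $\Delta$ is pure and its facets can be ordered $F_1,\dots,F_t$ so that for each $2\le j\le t$ the intersection of the complex of all subsets of $F_j$ with the complex generated by $F_1,\dots,F_{j-1}$ is generated by codimension one faces of $F_j$. *)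

(* Defs.v *)
From HB Require Import structures.
From mathcomp Require Import all_boot all_fingroup.
From mathcomp Require Import finmap.
From mathcomp Require Import boolp.

Set Implicit Arguments.
Unset Strict Implicit.
Unset Printing Implicit Defensive.

Local Open Scope fset_scope.

(** Everything is indexed from 0: [nat] plays the role of {1,2,3,...} and
    ['I_n] that of [n], so the number or matrix coordinate called [a] in
    1-based notation is [a - 1] here. *)

Section Complexes.
Variable K : choiceType.

(* The set of faces may be empty, and [[fset v]] need not be a face for every
   [v] in [vertices]. *)
Record complex := Complex {
  vertices : {fset K};
  faces : {fset {fset K}};
  faces_sub : forall E, E \in faces -> E `<=` vertices;
  faces_closed : forall E F, F \in faces -> E `<=` F -> E \in faces }.

Implicit Types (D : complex) (E F : {fset K}).

Definition lk_faces F D : {fset {fset K}} :=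
  [fset E in faces D | (E `&` F == fset0) && (E `|` F \in faces D)].

Definition del_faces F D : {fset {fset K}} :=
  [fset E in faces D | E `&` F == fset0].

Lemma disj_sub_vertices F D E :
  E \in faces D -> E `&` F == fset0 -> E `<=` vertices D `\` F.
Proof. by move=> ED EF; rewrite fsubsetD faces_sub // -fsetI_eq0. Qed.

Lemma disj_closed F E E' :
  E' `&` F == fset0 -> E `<=` E' -> E `&` F == fset0.
Proof.
by rewrite -!fsubset0 => E'F EE'; apply: fsubset_trans E'F; apply: fsetSI.
Qed.

Lemma lk_sub F D E : E \in lk_faces F D -> E `<=` vertices D `\` F.
Proof. by rewrite !inE => /and3P[ED EF _]; apply: disj_sub_vertices. Qed.

Lemma lk_closed F D E E' :
  E' \in lk_faces F D -> E `<=` E' -> E \in lk_faces F D.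
Proof.
rewrite !inE => /and3P[E'D E'F E'FD] EE'.
rewrite (faces_closed E'D EE') (disj_closed E'F EE') /=.
by apply: faces_closed E'FD _; apply: fsetSU.
Qed.

Lemma del_sub F D E : E \in del_faces F D -> E `<=` vertices D `\` F.
Proof. by rewrite !inE => /andP[ED EF]; apply: disj_sub_vertices. Qed.

Lemma del_closed F D E E' :
  E' \in del_faces F D -> E `<=` E' -> E \in del_faces F D.
Proof.
rewrite !inE => /andP[E'D E'F] EE'.
by rewrite (faces_closed E'D EE') (disj_closed E'F EE').
Qed.

Definition lk F D : complex := Complex (@lk_sub F D) (@lk_closed F D).
Definition del F D : complex := Complex (@del_sub F D) (@del_closed F D).

Definition facet D F : Prop :=
  F \in faces D /\ (forall E, E \in faces D -> F `<=` E -> E = F).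

(* The dimension of [F] is [#|` F| - 1]. *)
Definition pure D : Prop :=
  forall E F, facet D E -> facet D F -> #|` E| = #|` F|.

Inductive vertex_decomposable : complex -> Prop :=
| VD_void D of faces D = fset0 : vertex_decomposable D
| VD_empty D of faces D = [fset fset0] : vertex_decomposable D
| VD_step D v of v \in vertices D & pure D &
    vertex_decomposable (del [fset v] D) &
    vertex_decomposable (lk [fset v] D) : vertex_decomposable D.

(* The faces of the complex generated by the simplices in [G]. *)
Definition generated (G : seq {fset K}) : {fset {fset K}} :=
  \bigcup_(F <- G) fpowerset F.

Definition codim1_face F E : bool := (E `<=` F) && (#|` F| == #|` E|.+1).

Definition shellable D : Prop :=
  pure D /\
  exists2 s : seq {fset K},
    uniq s /\ (forall F, F \in s <-> facet D F) &
    forall j, 0 < j < size s ->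
      exists2 G : seq {fset K},
        all (codim1_face (nth fset0 s j)) G &
        fpowerset (nth fset0 s j) `&` generated (take j s) = generated G.

End Complexes.

Local Open Scope nat_scope.

Definition transp (a b x : nat) : nat :=
  if x == a then b else if x == b then a else x.

Definition compose (fs : seq (nat -> nat)) : nat -> nat :=
  foldr (fun f g => f \o g) id fs.

Definition perm_nat n (y : 'S_n) (x : nat) : nat :=
  if insub x is Some i then val (y i) else x.

(* The infinite product (m, m+1)(m+2, m+3)(m+4, m+5)... *)
Definition tail_swaps (m x : nat) : nat :=
  if x < m then x else if odd (x - m) then x.-1 else x.+1.

Definition involutions n : {set 'S_n} := [set y : 'S_n | (y ^+ 2 == 1)%g].

(* In increasing order, since [enum 'I_n] is increasing. *)
Definition fixed_points n (y : 'S_n) : seq nat :=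
  [seq val i | i <- enum 'I_n & y i == i].

Definition FPF n (y : 'S_n) : nat -> nat :=
  let s := fixed_points y in
  perm_nat y
  \o compose [seq transp p.1 p.2 | p <- zip s (iota n (size s))]
  \o tail_swaps (n + size s).

Definition in_FPF_image n (z : nat -> nat) : Prop :=
  exists2 y : 'S_n, y \in involutions n & z =1 FPF y.

Definition word_perm (w : seq nat) : nat -> nat :=
  compose [seq transp i i.+1 | i <- w].

Definition reduced_word (f : nat -> nat) (w : seq nat) : Prop :=
  word_perm w =1 f /\ (forall w', word_perm w' =1 f -> size w <= size w').

(* (i, -j) weakly increases lexicographically. *)
Definition reading_le (p q : nat * nat) : bool :=
  (p.1 < q.1) || ((p.1 == q.1) && (q.2 <= p.2)).

(* In 0-based notation the letter i + j - 1 at position (i, j) becomes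
   i + j. *)
Definition reading_word (D : {fset nat * nat}) : seq nat :=
  [seq p.1 + p.2 | p <- sort reading_le (enum_fset D)].

Definition RP (f : nat -> nat) (D : {fset nat * nat}) : Prop :=
  reduced_word f (reading_word D).

Definition transpose (D : {fset nat * nat}) : {fset nat * nat} :=
  [fset (p.2, p.1) | p in D].

(* The choice of [m] and [y] is immaterial, hence the existential. *)
Definition FP (z : nat -> nat) (E : {fset nat * nat}) : Prop :=
  exists m (y : 'S_m) (D : {fset nat * nat}),
    [/\ ~~ odd m,
        y \in involutions m /\ (forall i, y i != i),
        z =1 perm_nat y \o tail_swaps m,
        D = transpose D /\ RP (perm_nat y) D
      & E = [fset p in D | p.2 < p.1]].

Section Sigma.
Variables (z : nat -> nat) (Q : {fset nat * nat}).

Definition Sigma_faces : {fset {fset nat * nat}} :=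
  [fset S in fpowerset Q | `[< exists2 D, FP z D & D `<=` Q `\` S >]].

Lemma Sigma_sub S : S \in Sigma_faces -> S `<=` Q.
Proof. by rewrite !inE fpowersetE => /andP[]. Qed.

Lemma Sigma_closed S T : T \in Sigma_faces -> S `<=` T -> S \in Sigma_faces.
Proof.
rewrite !inE !fpowersetE => /andP[TQ /asboolP[D zD DQT]] ST.
rewrite (fsubset_trans ST TQ) /=; apply/asboolP; exists D => //.
by apply: fsubset_trans DQT _; apply: fsetDS.
Qed.

Definition Sigma : complex (nat * nat)%type := Complex Sigma_sub Sigma_closed.

End Sigma.

(* Main.v *)
(** Write the strands of a word [u] of cells below the diagonal as acting on the
    matching [Theta] = (0 1)(2 3)(4 5)...  A symmetric reduced pipe dream of a
    fixed-point-free involution contains the whole relevant diagonal, and reading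
    it from north-east to south-west gives the word [rev u ++ diagonal ++ u],
    where [u] reads the cells below the diagonal; so the elements of [FP z] are
    the sets whose word [u] is as short as possible among the words conjugating
    [Theta] to [z].  These words satisfy an exchange property: if [z] has a
    descent at [a] other than the swap of [a] and [a + 1], then two strands ending
    at [a, a + 1], or their partners, cross somewhere, and deleting that crossing
    conjugates [z] by [(a, a + 1)].  As for subword complexes (Knutson-Miller),
    removing the last cell [v] of [Q] then shows that the link of [v] is the
    complex of [z], and the deletion is that of the shorter conjugate of [z] or,
    when [v] is never used, that of [z] again. *)

Require Import Defs.
From mathcomp Require Import all_boot all_fingroup.
From mathcomp Require Import finmap.
From mathcomp Require Import boolp zify.
(* [all_fingroup] has its own [generated]. *)
Import Defs.

Set Implicit Arguments.
Unset Strict Implicit.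
Unset Printing Implicit Defensive.

(** * Vertex decomposable complexes are shellable *)

Section Shelling.
Local Open Scope fset_scope.
Variable K : choiceType.
Implicit Types (D : complex K) (E F X : {fset K}) (G : seq {fset K}).

Lemma generatedP X G : reflect (exists2 F, F \in G & X `<=` F) (X \in generated G).
Proof.
apply: (iffP idP) => [/bigfcupP[F /andP[FG _]]|[F FG XF]].
  by rewrite fpowersetE => XF; exists F.
by apply/bigfcupP; exists F; rewrite ?FG // fpowersetE.
Qed.

Lemma face_sub_facet D E :
  E \in faces D -> exists2 F, facet D F & E `<=` F.
Proof.
have [N] := ubnP (#|` vertices D| - #|` E|).
elim: N E => // N IHN E leN ED.
have [Emax|] := EM (facet D E); first by exists E.
rewrite /facet not_andP => -[//|/existsNP[F /not_implyP[FD /not_implyP[EF neq]]]].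
have ltEF : #|` E| < #|` F|.
  rewrite ltnNge; apply/negP => leFE; apply: neq; apply/esym/eqP.
  by rewrite eqEfcard EF.
have leF : #|` F| <= #|` vertices D| by rewrite fsubset_leq_card ?faces_sub.
have [|G Gmax FG] := IHN F _ FD; first by lia.
by exists G => //; apply: fsubset_trans FG.
Qed.

Lemma in_lk1 v D E :
  E \in faces (lk [fset v] D) = (v \notin E) && (v |` E \in faces D).
Proof.
rewrite !inE /= fsetI_eq0 fdisjointX1 [E `|` _]fsetUC.
case: (boolP (v |` E \in _)) => [vE|_]; last by rewrite !andbF.
by rewrite (faces_closed vE (fsubsetU1 _ _)) !andbT.
Qed.

Lemma in_del1 v D E :
  E \in faces (del [fset v] D) = (E \in faces D) && (v \notin E).
Proof. by rewrite !inE /= fsetI_eq0 fdisjointX1. Qed.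

Lemma facet_lk v D F :
  facet (lk [fset v] D) F <-> v \notin F /\ facet D (v |` F).
Proof.
rewrite /facet in_lk1; split=> [[/andP[vF FD] Fmax]|[vF [FD Fmax]]].
  split=> //; split=> // E ED /[dup] /fsubsetP FE.
  have vE : v \in E by rewrite FE // fset1U1.
  rewrite -{1}(fsetD1K vE) => sub.
  rewrite -(Fmax (E `\ v)); first by rewrite fsetD1K.
    by rewrite in_lk1 fsetD1K // ED !inE eqxx.
  apply/fsubsetP => x xF; rewrite !inE FE ?inE ?xF ?orbT // andbT.
  by apply: contraNneq vF => <-.
rewrite vF FD; split=> // E; rewrite in_lk1 => /andP[vE ED] FE.
have := Fmax _ ED (fsetUS _ FE) => /(congr1 (fun A => A `\ v)).
by rewrite !fsetU1K.
Qed.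

Lemma facet_del v D F : facet D F -> v \notin F -> facet (del [fset v] D) F.
Proof.
move=> [FD Fmax] vF; split; first by rewrite in_del1 FD.
by move=> E; rewrite in_del1 => /andP[ED _]; apply: Fmax.
Qed.

(* A facet of the deletion is not a facet of [D] only when [D] is a cone with
   apex [v]: purity of [D] and of its deletion forbids the mixed case. *)
Lemma del_facets v D :
  pure D -> pure (del [fset v] D) ->
  (forall F, facet (del [fset v] D) F -> facet D F) \/
  (forall F, facet D F -> v \in F).
Proof.
move=> pD pdel; have [|/existsNP[F /not_implyP[Fdel nF]]] :=
  EM (forall F, facet (del [fset v] D) F -> facet D F); first by left.
right=> F' F'D; apply/negPn/negP => vF'.
have eqc := pdel _ _ (facet_del F'D vF') Fdel.
have [FD vF] : F \in faces D /\ v \notin F.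
  by have [/[!in_del1] /andP[]] := Fdel.
have [E [ED Emax] FE] := face_sub_facet FD.
have eqc' := pD _ _ F'D (conj ED Emax).
apply: nF; suff -> : F = E by [].
by apply/eqP; rewrite eqEfcard FE -eqc -eqc' leqnn.
Qed.

(** A set X lies in A with [v] added exactly when X without [v] lies in A, so both sides are tested
    on X without [v]. *)
Lemma generated_cone v F G G' :
  fpowerset F `&` generated G = generated G' ->
  fpowerset (v |` F) `&` generated (map (fsetU [fset v]) G)
    = generated (map (fsetU [fset v]) G').
Proof.
move=> eqG; have E X L : (X \in generated (map (fsetU [fset v]) L)) =
    (X `\ v \in generated L).
  apply/generatedP/generatedP => [[_ /mapP[A AL ->] XA]|[A AL XA]].
    by exists A; rewrite ?fsubDset.
  by exists (v |` A); rewrite -?fsubDset // map_f.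
by apply/fsetP => X; rewrite inE !E -eqG inE !fpowersetE fsubDset.
Qed.

Lemma codim1_cone v F G :
  v \notin F -> all (codim1_face F) G ->
  all (codim1_face (v |` F)) (map (fsetU [fset v]) G).
Proof.
move=> vF /allP codF; apply/allP => _ /mapP[A /codF /andP[AF /eqP cA] ->].
have vA : v \notin A by apply: contra vF; apply: (fsubsetP AF).
by rewrite /codim1_face fsetUS // !cardfsU1 vF vA cA addnS /=.
Qed.

Definition shelling D (s : seq {fset K}) :=
  [/\ uniq s, forall F, F \in s <-> facet D F &
    forall j, 0 < j < size s ->
      exists2 G : seq {fset K},
        all (codim1_face (nth fset0 s j)) G &
        fpowerset (nth fset0 s j) `&` generated (take j s) = generated G].

Lemma shellableE D : shellable D <-> pure D /\ exists s, shelling D s.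
Proof.
split=> -[pD [s]]; first by move=> [us sD] sh; split=> //; exists s.
by case=> us sD sh; split=> //; exists s.
Qed.

(** [D] is a cone with apex [v] over its link, and coning preserves the intersections with earlier
    facets. *)
Lemma shelling_cone v D sl :
  (forall F, facet D F -> v \in F) -> shelling (lk [fset v] D) sl ->
  shelling D (map (fsetU [fset v]) sl).
Proof.
move=> Dv [us slD sh].
have vsl F : F \in sl -> v \notin F by move=> /slD /facet_lk[].
split=> [|F|j].
- rewrite map_inj_in_uniq // => A B /vsl vA /vsl vB.
  by move=> /(congr1 (fun A => A `\ v)); rewrite !fsetU1K.
- split=> [/mapP[A /slD /facet_lk[_ ?] ->] //|FD].
  apply/mapP; exists (F `\ v); last by rewrite fsetD1K ?Dv.
  by apply/slD/facet_lk; rewrite fsetD1K; [rewrite !inE eqxx|apply: Dv].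
rewrite size_map => /[dup] /andP[_ ltj] /sh[G codG eqG].
exists (map (fsetU [fset v]) G); rewrite (nth_map fset0) //.
  by rewrite codim1_cone // vsl // mem_nth.
by rewrite -map_take; apply: generated_cone.
Qed.

(** The facets avoiding [v] come first. A later facet, [F] with [v] added, meets the complex they
    generate in exactly the subsets of [F], which has codimension one, and meets the earlier cones
    in cones over intersections in the link. *)
Lemma shelling_del_lk v D sd sl :
  (forall F, facet (del [fset v] D) F -> facet D F) ->
  shelling (del [fset v] D) sd -> shelling (lk [fset v] D) sl ->
  shelling D (sd ++ map (fsetU [fset v]) sl).
Proof.
move=> delD [ud sdD shd] [ul slD shl].
have vsl F : F \in sl -> v \notin F by move=> /slD /facet_lk[].
have vsd F : F \in sd -> v \notin F.
  by move=> /sdD[]; rewrite in_del1 => /andP[].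
split=> [|F|j].
- rewrite cat_uniq ud map_inj_in_uniq ?ul ?andbT /=; last first.
    move=> A B /vsl vA /vsl vB.
    by move=> /(congr1 (fun A => A `\ v)); rewrite !fsetU1K.
  apply/hasPn => _ /mapP[A _ ->]; apply/negP => /vsd.
  by rewrite !inE eqxx.
- rewrite mem_cat; split=> [/orP[/sdD/delD //|]|FD].
    by move=> /mapP[A /slD /facet_lk[_ ?] ->].
  have [vF|vF] := boolP (v \in F); apply/orP; [right|left].
    apply/mapP; exists (F `\ v); last by rewrite fsetD1K.
    by apply/slD/facet_lk; rewrite fsetD1K // !inE eqxx.
  exact/sdD/facet_del.
rewrite size_cat size_map nth_cat take_cat.
have [ltj /andP[j0 _]|lej /andP[_ ltj]] := ltnP j (size sd).
  by apply: shd; rewrite j0.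
have {ltj} : j - size sd < size sl by lia.
move: (j - size sd) => i lti; rewrite (nth_map fset0) // -map_take.
set F := nth _ _ _; have Fsl : F \in sl by rewrite mem_nth.
have [vF Fdel] : v \notin F /\ F \in faces (del [fset v] D).
  have /slD[] := Fsl; rewrite in_lk1 => /andP[vF FD] _.
  by rewrite in_del1 vF (faces_closed FD) ?fsubsetU1.
(* The shelling condition of the link starts at index 1; the first cone has no earlier one, so [G]
   is empty there. *)
have [G codG eqG] : exists2 G, all (codim1_face F) G &
    fpowerset F `&` generated (take i sl) = generated G.
  case: (posnP i) => [->|i0]; last by apply: shl; rewrite i0.
  exists [::] => //; rewrite take0; apply/fsetP => X.
  by rewrite inE /generated big_nil !inE andbF.
exists (F :: map (fsetU [fset v]) G).
  rewrite /= codim1_cone // andbT /codim1_face fsubsetU1 cardfsU1 vF.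
  by rewrite eqxx.
have split_gen A B : generated (A ++ B) = generated A `|` generated B.
  by rewrite /generated big_cat.
have -> : generated (F :: map (fsetU [fset v]) G) =
   fpowerset F `|` generated (map (fsetU [fset v]) G).
  by rewrite /generated big_cons.
rewrite split_gen fsetIUr (generated_cone v eqG); congr (_ `|` _).
apply/fsetP => X; rewrite inE !fpowersetE; apply/andP/idP => [[XF]|XF].
  move=> /generatedP[A /vsd vA XA]; rewrite -[X](@mem_fsetD1 _ v).
    by rewrite fsubDset.
  by apply: contra vA; apply: (fsubsetP XA).
split; first by apply: fsubset_trans XF (fsubsetU1 _ _).
have [A /sdD AD FA] := face_sub_facet Fdel.
by apply/generatedP; exists A => //; apply: fsubset_trans FA.
Qed.

Lemma vertex_decomposable_shellable D :
  vertex_decomposable D -> shellable D.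
Proof.
elim=> {D} [D D0|D D0|D v _ pD _ /shellableE[pdel [sd shd]] _ /shellableE[_ [sl shl]]].
- apply/shellableE; split; first by move=> E F []; rewrite D0.
  exists [::]; split=> // [F|j]; last by rewrite andbF.
  by split=> // -[]; rewrite D0.
- have facetE F : facet D F <-> F = fset0.
    rewrite /facet D0 inE; split=> [[/eqP]//|->]; split=> // E.
    by rewrite inE => /eqP.
  apply/shellableE; split; first by move=> E F /facetE-> /facetE->.
  exists [:: fset0]; split=> // [F|[|]//].
  by rewrite inE facetE; split=> /eqP.
(* If all facets contain [v], the deletion contributes none and coning the link suffices. *)
apply/shellableE; split=> //; have [delD|Dv] := del_facets pD pdel.
  by exists (sd ++ map (fsetU [fset v]) sl); apply: shelling_del_lk.
by exists (map (fsetU [fset v]) sl); apply: shelling_cone.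
Qed.

End Shelling.

(** * Words and the exchange property *)

Lemma transpK a b : involutive (transp a b).
Proof. by move=> x; rewrite /transp; do !case: eqP => //; congruence. Qed.

Lemma transpC a b : transp a b =1 transp b a.
Proof. by move=> x; rewrite /transp; do !case: eqP => //; congruence. Qed.

Lemma transp_conj (f : nat -> nat) a b x :
  injective f -> transp (f a) (f b) (f x) = f (transp a b x).
Proof. by move=> f_inj; rewrite /transp !(inj_eq f_inj); do !case: ifP. Qed.

Lemma transp_gt b p q :
  p < q -> transp b b.+1 q < transp b b.+1 p -> p = b /\ q = b.+1.
Proof. by rewrite /transp; do !case: eqP => ?; lia. Qed.

Lemma word_perm_cons b w x :
  word_perm (b :: w) x = transp b b.+1 (word_perm w x).
Proof. by []. Qed.

Lemma word_perm_cat w1 w2 x :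
  word_perm (w1 ++ w2) x = word_perm w1 (word_perm w2 x).
Proof. by elim: w1 => //= b w1; rewrite !word_perm_cons => ->. Qed.

Lemma word_perm_rcons w b x :
  word_perm (rcons w b) x = word_perm w (transp b b.+1 x).
Proof. by rewrite -cats1 word_perm_cat. Qed.

Lemma word_perm_inj w : injective (word_perm w).
Proof.
elim: w => [|b w IHw] x y //= /(congr1 (transp b b.+1)).
by rewrite !word_perm_cons !transpK => /IHw.
Qed.

Lemma word_perm_revK w : cancel (word_perm w) (word_perm (rev w)).
Proof.
elim: w => // b w IHw x.
by rewrite rev_cons word_perm_rcons word_perm_cons transpK IHw.
Qed.

Lemma word_permK w : cancel (word_perm (rev w)) (word_perm w).
Proof. by rewrite -{2}(revK w); apply: word_perm_revK. Qed.

Lemma word_perm_fix w x :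
  all (fun b => (x != b) && (x != b.+1)) w -> word_perm w x = x.
Proof.
elim: w => //= b w IHw /andP[/andP[xb xb1] /IHw eqx].
by rewrite word_perm_cons eqx /transp (negPf xb) (negPf xb1).
Qed.

Lemma word_perm_lt m w x :
  all (fun b => b.+1 < m) w -> x < m -> word_perm w x < m.
Proof.
elim: w => //= b w IHw /andP[ltb /IHw{}IHw] /IHw; rewrite word_perm_cons.
by move: (word_perm _ _) => y; rewrite /transp; do !case: eqP => ?; lia.
Qed.

Lemma word_perm_ge m w x :
  all (fun b => b.+1 < m) w -> m <= x -> word_perm w x = x.
Proof.
move=> /allP ltw lex; apply/word_perm_fix/allP => b /ltw ltb.
by apply/andP; split; lia.
Qed.

(** The first letter acts last. Peeling letters off the front isolates a letter [b] at which the
    strands, in order until then, are swapped. They sit at [b] and [b.+1] there, so erasing [b]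
    amounts to composing with [transp x y] on the right. *)
Lemma exchange w x y :
  x < y -> word_perm w y < word_perm w x ->
  exists2 i, i < size w &
    word_perm (take i w ++ drop i.+1 w) =1 word_perm w \o transp x y.
Proof.
move=> ltxy; elim: w => [|b w IHw]; first by rewrite /word_perm /=; lia.
have [/IHw[i lti eqi] _|le] := ltnP (word_perm w y) (word_perm w x).
  by exists i.+1 => // t; have := eqi t; rewrite /word_perm /= => ->.
have {le}lt : word_perm w x < word_perm w y.
  by rewrite ltn_neqAle le andbT (inj_eq (@word_perm_inj w)); lia.
move=> /(transp_gt lt)[eqx eqy]; exists 0 => // t.
rewrite take0 drop1 /= -[word_perm (b :: w) _]/(transp b b.+1 (word_perm w _)).
by rewrite -eqy -eqx -transp_conj ?transpK //; apply: word_perm_inj.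
Qed.

Lemma size_delete (T : Type) i (w : seq T) :
  i < size w -> size w = (size (take i w ++ drop i.+1 w)).+1.
Proof. by move=> lti; rewrite size_cat size_take size_drop lti; lia. Qed.

Lemma last_occurrence (T : eqType) (b : T) w :
  b \in w -> exists w1 w2, w = w1 ++ b :: w2 /\ b \notin w2.
Proof.
elim: w => // c w IHw; have [/IHw[w1 [w2 [-> bw2]]] _|bw] := boolP (b \in w).
  by exists (c :: w1), w2.
by rewrite inE (negPf bw) orbF => /eqP<-; exists [::], w.
Qed.

Lemma max_letter m w :
  ~~ all (fun b => b.+1 < m) w ->
  exists2 b, b \in w & m <= b.+1 /\ all (fun c => c <= b) w.
Proof.
elim: w => //= c w IHw; rewrite negb_and.
have [allw|/IHw[b bw [leb allb]]] := boolP (all (fun b => b.+1 < m) w).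
  rewrite orbF -leqNgt => lec; exists c; rewrite ?mem_head //; split=> //.
  rewrite leqnn /=; apply: sub_all allw => d /= ltd; lia.
move=> _; have [lecb|ltbc] := leqP c b.
  by exists b; rewrite ?inE ?bw ?orbT ?lecb.
exists c; rewrite ?mem_head // leqnn; split; first by lia.
by apply: sub_all allb => d /= led; lia.
Qed.

(* If [b] is the largest letter, the strand starting at [b.+1] leaves
   through the rightmost [b] and has to come back, so that crossing can be
   cancelled against a later one. *)
Lemma reduced_letters f w m :
  reduced_word f w -> (forall x, m <= x -> f x = x) ->
  all (fun b => b.+1 < m) w.
Proof.
move=> [wf wmin] f_fix; apply/negPn/negP => /max_letter[b bw [leb allb]].
have [w1 [w2 [eqw bw2]]] := last_occurrence bw.
have fix2 : word_perm w2 b.+1 = b.+1.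
  apply/word_perm_fix/allP => c cw2.
  have : c <= b by apply: (allP allb); rewrite eqw mem_cat inE cw2 !orbT.
  have : c != b by apply: contraNneq bw2 => <-.
  by move=> /eqP; lia.
have w1b : word_perm w1 b = b.+1.
  have := wf b.+1; rewrite f_fix // eqw -cat_rcons word_perm_cat fix2.
  by rewrite word_perm_rcons /transp eqxx gtn_eqF.
(* All letters are at most [b], so [w1] sends [b.+1] to at most [b.+1]; as [b] already goes there,
   the strands [b] and [b.+1] cross again in [w1]. *)
have ltw1 : word_perm w1 b.+1 < b.+2.
  apply: word_perm_lt => //; apply/allP => c cw1.
  by rewrite !ltnS; apply: (allP allb); rewrite eqw mem_cat cw1.
have neqw1 : word_perm w1 b.+1 != b.+1.
  by rewrite -{2}w1b (inj_eq (@word_perm_inj w1)); lia.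
have [||i lti eqi] := @exchange w1 b b.+1; [by []|by rewrite w1b; lia|].
(* Erasing that crossing together with the letter [b] leaves the permutation unchanged and saves two
   letters. *)
suff /wmin : word_perm ((take i w1 ++ drop i.+1 w1) ++ w2) =1 f.
  rewrite eqw !size_cat /= (size_delete lti) !size_cat; lia.
move=> x; rewrite word_perm_cat eqi -wf eqw -cat_rcons word_perm_cat.
by rewrite word_perm_rcons.
Qed.

(** * Words conjugating the matching [Theta] *)

Definition Theta x := if odd x then x.-1 else x.+1.

Lemma ThetaK : involutive Theta.
Proof. move=> x; rewrite /Theta; do !case: ifP; lia. Qed.

Lemma Theta_neq x : Theta x <> x.
Proof. rewrite /Theta; case: ifP; lia. Qed.

Lemma Theta_lt k x : (Theta x < k.*2) = (x < k.*2).
Proof. rewrite /Theta; case: ifP; lia. Qed.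

(** The pairs of [Theta] consist of consecutive numbers, so only the two members of one pair change
    their order. *)
Lemma Theta_mono p q : p < q -> Theta p <> q -> Theta p < Theta q.
Proof. rewrite /Theta; do !case: ifP; lia. Qed.

Lemma tail_swapsE k x :
  tail_swaps k.*2 x = if x < k.*2 then x else Theta x.
Proof.
rewrite /tail_swaps; case: ltnP => // lex.
by rewrite oddB // odd_double addbF.
Qed.

(* Without inverses: [z] is the conjugate of [Theta] by the product of [u]. *)
Definition fword u (z : nat -> nat) : Prop :=
  forall x, word_perm u (z x) = Theta (word_perm u x).

Definition reduced_fword u z : Prop :=
  fword u z /\ forall u', fword u' z -> size u <= size u'.

Definition sconj a (z : nat -> nat) x :=
  transp a a.+1 (z (transp a a.+1 x)).

(** For an involution with [z a = a.+1], conjugation by the transposition of [a] and [a.+1] fixes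
    [z], so this descent is excluded. *)
Definition fdescent a (z : nat -> nat) := z a.+1 < z a /\ z a <> a.+1.

Section Fword.
Variables (u : seq nat) (z : nat -> nat).
Hypothesis uz : fword u z.

Lemma fword_invol : involutive z.
Proof. by move=> x; apply: (@word_perm_inj u); rewrite !uz ThetaK. Qed.

Lemma fword_fpf x : z x <> x.
Proof. by move=> /(congr1 (word_perm u)); rewrite uz => /Theta_neq. Qed.

Lemma fword_sconj a : fword (rcons u a) (sconj a z).
Proof. by move=> x; rewrite !word_perm_rcons /sconj transpK uz. Qed.

End Fword.

Lemma fword_ext u z z' : z =1 z' -> fword u z -> fword u z'.
Proof. by move=> eqz uz x; rewrite -eqz. Qed.

Lemma sconjK a z : sconj a (sconj a z) =1 z.
Proof. by move=> x; rewrite /sconj !transpK. Qed.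

Lemma fword_rcons u a z : fword (rcons u a) z -> fword u (sconj a z).
Proof.
by move=> uz x; have := uz (transp a a.+1 x); rewrite !word_perm_rcons transpK.
Qed.

(* [(a, a+1)] and its [z]-conjugate have disjoint supports, hence commute. *)
Lemma sconj_transp a z :
  involutive z -> (forall x, z x <> x) -> z a <> a.+1 ->
  z \o transp a a.+1 \o transp (z a.+1) (z a) =1 sconj a z.
Proof.
move=> zK zF za x; have z_inj := inv_inj zK; rewrite /sconj /=.
have za1 : z a.+1 <> a by move=> /(congr1 z); rewrite zK => /esym.
have := zF a; have := zF a.+1; have := zK a; have := zK a.+1.
rewrite /transp.
have [->|] := eqVneq x (z a.+1).
  by do !case: eqP => //; congruence.
have [->|] := eqVneq x (z a).
  by do !case: eqP => //; congruence.
have [->|] := eqVneq x a; first by do !case: eqP => //; congruence.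
have [->|] := eqVneq x a.+1; first by do !case: eqP => //; congruence.
by have := zK x; do !case: eqP => //; congruence.
Qed.

(** If the strands [a] and [a.+1] do not cross in [u], then [Theta] carries their order after [u]
    over to the partners [z a] and [z a.+1], which start in the opposite order and so cross. Erasing
    either crossing yields the same conjugate. *)
Lemma fword_exchange u z a :
  fword u z -> fdescent a z ->
  exists2 i, i < size u & fword (take i u ++ drop i.+1 u) (sconj a z).
Proof.
move=> uz [ltz za]; have zK := fword_invol uz; have zF := fword_fpf uz.
have [lt|le] := ltnP (word_perm u a.+1) (word_perm u a).
  have [i lti eqi] := exchange (ltnSn a) lt; exists i => // x.
  by rewrite !eqi /sconj /= transpK uz.
have {le}lt : word_perm u a < word_perm u a.+1.
  by rewrite ltn_neqAle le andbT (inj_eq (@word_perm_inj u)) neq_ltn ltnSn.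
have ltz' : word_perm u (z a) < word_perm u (z a.+1).
  rewrite !uz; apply: Theta_mono => //; rewrite -uz => /word_perm_inj.
  exact: za.
have [i lti eqi] := exchange ltz ltz'; exists i => //.
(* With t the transposition of the partners, t z t = z s t, where s = z t z transposes [a] and
   [a.+1]. *)
apply: fword_ext (sconj_transp zK zF za) _ => x.
rewrite !eqi /= transp_conj; last exact: inv_inj.
by rewrite (transpC a.+1) transpK uz.
Qed.

(** * Vertex decomposition *)

Lemma reading_le_total : total reading_le.
Proof. by move=> p q; rewrite /reading_le; case: (ltngtP p.1 q.1); lia. Qed.

Lemma reading_le_trans : transitive reading_le.
Proof. by move=> q p r; rewrite /reading_le; lia. Qed.

Lemma reading_le_anti : antisymmetric reading_le.
Proof.
move=> [a b] [c d]; rewrite /reading_le /= => le2.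
by have [-> ->] : a = c /\ b = d by lia.
Qed.

Definition cells (D : {fset nat * nat}) : seq (nat * nat) :=
  sort reading_le (enum_fset D).

Lemma reading_wordE D : reading_word D = [seq p.1 + p.2 | p <- cells D].
Proof. by []. Qed.

Lemma mem_cells D p : (p \in cells D) = (p \in D).
Proof. by rewrite mem_sort. Qed.

Lemma cells_uniq D : uniq (cells D).
Proof. by rewrite sort_uniq fset_uniq. Qed.

Lemma cells_sorted D : sorted reading_le (cells D).
Proof. exact: sort_sorted reading_le_total _. Qed.

Lemma cells_eq D s : sorted reading_le s -> uniq s -> s =i D -> cells D = s.
Proof.
move=> ss us eqs; apply: (sorted_eq reading_le_trans reading_le_anti) => //.
  exact: cells_sorted.
apply: uniq_perm => // [|p]; first exact: cells_uniq.
by rewrite mem_cells eqs.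
Qed.

Lemma size_reading_word D : size (reading_word D) = #|` D|%fset.
Proof. by rewrite size_map size_sort. Qed.

(** Transfers the exchange property from letters to cells: the cell to remove is the one read at
    position [i]. *)
Lemma reading_word_delete D i :
  i < size (reading_word D) ->
  exists2 c, c \in D &
    reading_word (D `\ c)%fset =
      take i (reading_word D) ++ drop i.+1 (reading_word D).
Proof.
rewrite !reading_wordE size_map => lti; set s := cells D.
set c := nth (0, 0) s i; exists c; first by rewrite -mem_cells mem_nth.
have eqs : s = take i s ++ c :: drop i.+1 s by rewrite -drop_nth // cat_take_drop.
rewrite -map_take -map_drop -map_cat -/s; congr map; apply: cells_eq.
- apply: subseq_sorted (cells_sorted D); first exact: reading_le_trans.
  by rewrite -/s {3}eqs cat_subseq // subseq_cons.
- have := cells_uniq D; rewrite -/s {1}eqs -cat_rcons -cats1 -catA uniq_catCA /=.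
  by case/andP.
move=> p; rewrite !inE -mem_cells -/s {3}eqs.
have := cells_uniq D; rewrite -/s {1}eqs -cat_rcons -cats1 -catA uniq_catCA /=.
rewrite !mem_cat !inE => /andP[]; case: (eqVneq p c) => [->|_] //=.
by move=> /negPf.
Qed.

Lemma last_cell (Q : {fset nat * nat}) :
  Q != fset0 -> exists2 v, v \in Q & {in Q, forall p, reading_le p v}.
Proof.
move=> /fset0Pn[q]; rewrite -mem_cells.
have := cells_sorted Q; case: (lastP (cells Q)) (mem_cells Q) => // s v memQ.
rewrite -(rev_sorted) rev_rcons /= path_sortedE; last first.
  by move=> a b c ? ?; apply: (@reading_le_trans a).
move=> /andP[/allP le_v _] _; exists v; first by rewrite -memQ mem_rcons mem_head.
move=> p; rewrite -memQ mem_rcons inE => /predU1P[->|ps].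
  by have := reading_le_total v v; rewrite orbb.
by apply: le_v; rewrite mem_rev.
Qed.

Lemma reading_word_rcons D v :
  v \in D -> {in D, forall p, reading_le p v} ->
  reading_word D = rcons (reading_word (D `\ v)%fset) (v.1 + v.2).
Proof.
move=> vD le_v; rewrite !reading_wordE -(map_rcons (fun p => p.1 + p.2)).
congr map; apply: cells_eq => [||p].
- rewrite -rev_sorted rev_rcons /= path_sortedE; last first.
    by move=> a b c ? ?; apply: (@reading_le_trans a).
  rewrite rev_sorted cells_sorted andbT; apply/allP => p.
  by rewrite mem_rev mem_cells !inE => /andP[_ /le_v].
- by rewrite rcons_uniq cells_uniq mem_cells !inE eqxx.
by rewrite mem_rcons inE mem_cells !inE; case: eqP => // ->.
Qed.

Lemma reduced_fword_descent u z a :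
  reduced_fword (rcons u a) z -> fdescent a z.
Proof.
move=> [uaz uamin]; have uz := fword_rcons uaz.
have zK := fword_invol uaz; have zF := fword_fpf uaz.
have za : z a <> a.+1.
  move=> za; have za1 : z a.+1 = a by rewrite -za zK.
  suff /uamin : fword u z by rewrite size_rcons ltnn.
  apply: fword_ext uz => x; rewrite /sconj.
  have := zK x; rewrite /transp.
  by do !case: eqP => //; congruence.
split=> //; have [//|le] := ltnP (z a.+1) (z a).
have za1 : z a.+1 <> a by move=> /(congr1 z); rewrite zK => /esym.
have [|i lti] := @fword_exchange u (sconj a z) a uz.
  have lt : z a < z a.+1.
    by rewrite ltn_neqAle le (inj_eq (inv_inj zK)) neq_ltn ltnSn.
  have := zF a; have := zF a.+1.
  rewrite /fdescent /sconj /transp !eqxx.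
  by do !case: eqP => //; try congruence; lia.
move=> /(fword_ext (@sconjK a z)) /uamin.
by rewrite size_rcons (size_delete lti); lia.
Qed.

(** At a descent, conjugation lowers the minimal length by exactly one: appending [a] gives one
    inequality, exchange the other. *)
Lemma reduced_fword_rcons u z a :
  fdescent a z -> reduced_fword u (sconj a z) <-> reduced_fword (rcons u a) z.
Proof.
move=> za; split=> -[uz umin]; split=> [|u' u'z].
- by apply: fword_ext (@sconjK a z) _; apply: fword_sconj.
- have [i lti /umin] := fword_exchange u'z za.
  by rewrite size_rcons (size_delete lti).
- exact: fword_rcons.
rewrite -ltnS -!(size_rcons _ a); apply: umin.
by apply: fword_ext (@sconjK a z) _; apply: fword_sconj.
Qed.

Lemma reduced_fword_exchange u z a :
  reduced_fword u z -> fdescent a z ->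
  exists2 i, i < size u & reduced_fword (take i u ++ drop i.+1 u) (sconj a z).
Proof.
move=> [uz umin] za; have [i lti u'z] := fword_exchange uz za.
exists i => //; split=> // u'' u''z.
have := umin _ (fword_ext (@sconjK a z) (fword_sconj u''z a)).
by rewrite size_rcons (size_delete lti).
Qed.

(** * Complexes of minimal words: purity, links and deletions *)

Section SubwordComplex.
Local Open Scope fset_scope.

(** Stated as a property of [D], so that links and deletions are recognised as such complexes
    without equality of records. *)
Definition subword_complex z Q (D : complex (nat * nat)%type) :=
  vertices D = Q /\ forall S, S \in faces D <->
    S `<=` Q /\ exists2 E, reduced_fword (reading_word E) z & E `<=` Q `\` S.

(** A facet is the complement in [Q] of the cells of a minimal word, and minimal words have equal
    length. *)
Lemma subword_complex_pure z Q D : subword_complex z Q D -> pure D.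
Proof.
move=> [_ facesD].
have cardD F : facet D F ->
    exists2 E, reduced_fword (reading_word E) z & (#|` F| + #|` E| = #|` Q|)%N.
  case=> /facesD[FQ [E Ez EQF]] Fmax; exists E => //.
  have EQ : E `<=` Q by apply: fsubset_trans EQF (fsubsetDl _ _).
  rewrite -(Fmax (Q `\` E)).
  - by rewrite cardfsDS // subnK // fsubset_leq_card.
  - apply/facesD; split; first exact: fsubsetDl.
    by exists E => //; rewrite fsetDK.
  move: EQF; rewrite !fsubsetD FQ => /andP[_].
  by rewrite fdisjoint_sym.
move=> F F' /cardD[E [Ez Emin] cE] /cardD[E' [E'z E'min] cE'].
have := Emin _ E'z; have := E'min _ Ez; rewrite !size_reading_word.
by lia.
Qed.

Lemma subword_complex_lk z Q D v :
  v \in Q -> subword_complex z Q D ->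
  subword_complex z (Q `\ v) (lk [fset v] D).
Proof.
move=> vQ [VD facesD]; split=> [|S]; first by rewrite /= VD.
have eqQ : Q `\` (v |` S) = Q `\ v `\` S by rewrite fsetDDl.
rewrite in_lk1 fsubsetD1; split=> [/andP[vS /facesD[SQ]]|].
  rewrite eqQ => exE; rewrite vS; split=> //.
  by rewrite (fsubset_trans _ SQ) ?fsubsetU1.
move=> [/andP[SQ vS] exE]; rewrite vS; apply/facesD.
by rewrite eqQ fsubUset fsub1set vQ SQ.
Qed.

(** The cell [v] is read last. A set [E] containing [v] loses [v]; one avoiding [v] loses the cell
    given by exchange. Conversely [v] can be put back, since faces of the deletion avoid it. *)
Lemma subword_complex_del_descent z Q D v :
  v \in Q -> {in Q, forall p, reading_le p v} -> fdescent (v.1 + v.2)%N z ->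
  subword_complex z Q D ->
  subword_complex (sconj (v.1 + v.2)%N z) (Q `\ v) (del [fset v] D).
Proof.
move=> vQ le_v zv [VD facesD]; split=> [|S]; first by rewrite /= VD.
rewrite in_del1 fsubsetD1; split=> [/andP[/facesD[SQ [E Ez EQS]] vS]|].
  rewrite vS SQ; split=> //; have [vE|vE] := boolP (v \in E).
    exists (E `\ v).
      apply/(reduced_fword_rcons _ zv); rewrite -reading_word_rcons // => p pE.
      by apply: le_v; have := fsubsetP EQS p pE; rewrite in_fsetD => /andP[].
    by rewrite fsetDDl fsetUC -fsetDDl fsetSD.
  have [i lti] := reduced_fword_exchange Ez zv.
  have [c cE <-] := reading_word_delete lti => Ecz; exists (E `\ c) => //.
  rewrite fsetDDl fsetUC -fsetDDl fsubsetD1 (fsubset_trans (fsubsetDl _ _) EQS).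
  by rewrite inE negb_and vE orbT.
move=> [/andP[SQ vS] [E Ez EQS]]; rewrite vS andbT; apply/facesD; split=> //.
have vE : v \notin E.
  by apply/negP => /(fsubsetP EQS); rewrite !inE eqxx andbF.
exists (v |` E).
  rewrite (@reading_word_rcons _ v) ?fset1U1 //; last first.
    move=> p; rewrite !inE => /predU1P[->|/(fsubsetP EQS)].
      exact: le_v.
    by rewrite !inE => /andP[_ /andP[_]]; apply: le_v.
  by rewrite fsetU1K //; apply/(reduced_fword_rcons _ zv).
rewrite fsubUset fsub1set inE vS vQ.
by apply: fsubset_trans EQS _; rewrite fsetSD // fsubsetDl.
Qed.

(** Any [E] containing [v] would read it last, and the last letter of a minimal word is a descent;
    so no [E] uses [v], and [D] is a cone with apex [v]. *)
Lemma subword_complex_del_cone z Q D v :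
  v \in Q -> {in Q, forall p, reading_le p v} -> ~ fdescent (v.1 + v.2)%N z ->
  subword_complex z Q D ->
  subword_complex z (Q `\ v) (del [fset v] D).
Proof.
move=> vQ le_v zv [VD facesD]; split=> [|S]; first by rewrite /= VD.
rewrite in_del1 fsubsetD1; split=> [/andP[/facesD[SQ [E Ez EQS]] vS]|].
  rewrite vS SQ; split=> //; exists E => //.
  have vE : v \notin E.
    apply/negP => vE; apply: zv; apply: (@reduced_fword_descent (reading_word (E `\ v))).
    rewrite -reading_word_rcons // => p pE.
    by apply: le_v; have := fsubsetP EQS p pE; rewrite in_fsetD => /andP[].
  by rewrite fsetDDl fsetUC -fsetDDl fsubsetD1 EQS.
move=> [/andP[SQ vS] [E Ez EQS]]; rewrite vS andbT; apply/facesD; split=> //.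
exists E => //.
by apply: fsubset_trans EQS _; rewrite fsetSD // fsubsetDl.
Qed.

Lemma subword_complex_vd z Q D :
  subword_complex z Q D -> vertex_decomposable D.
Proof.
have [N] := ubnP #|` Q|; elim: N z Q D => // N IHN z Q D leN zQD.
have [D0|/fset0Pn[S SD]] := eqVneq (faces D) fset0; first exact: VD_void.
have [Q0|/last_cell[v vQ le_v]] := eqVneq Q fset0.
  (* With [Q] empty only the empty face is possible, and it is present because the void complex was
     treated first. *)
  have SubD T : T \in faces D -> T = fset0.
    by case: zQD => _ facesD /facesD[]; rewrite Q0 fsubset0 => /eqP.
  apply: VD_empty; apply/fsetP => T; rewrite inE.
  by apply/idP/eqP => [/SubD//|->]; rewrite -(SubD S).
have ltQ : #|` Q `\ v| < N by rewrite (cardfsD1 v Q) vQ in leN.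
apply: (@VD_step _ _ v).
- by case: zQD => ->.
- exact: subword_complex_pure zQD.
- have [zv|zv] := EM (fdescent (v.1 + v.2)%N z).
    by apply: IHN ltQ (subword_complex_del_descent vQ le_v zv zQD).
  by apply: IHN ltQ (subword_complex_del_cone vQ le_v zv zQD).
by apply: IHN ltQ (subword_complex_lk vQ zQD).
Qed.

End SubwordComplex.

(** * Symmetric pipe dreams *)

(* [q] lies weakly north-east of [p]. *)
Definition precedes (q p : nat * nat) := (q.1 <= p.1) && (p.2 <= q.2).

(** The linear extensions of the north-east order; as [precedes] is reflexive, the entries are also
    distinct. *)
Definition admissible := pairwise (fun p q => ~~ precedes q p).

Lemma word_perm_comm a w x :
  all (fun b => (a.+1 < b) || (b.+1 < a)) w ->
  word_perm w (transp a a.+1 x) = transp a a.+1 (word_perm w x).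
Proof.
elim: w => //= b w IHw /andP[ab /IHw eqw].
rewrite !word_perm_cons eqw; move: (word_perm w x) => y.
by rewrite /transp; do !case: eqP => //; lia.
Qed.

(** Incomparable cells differ in both coordinates in the same direction, so their letters differ by
    at least two. *)
Lemma precedes_letters p q :
  ~~ precedes p q -> ~~ precedes q p ->
  ((p.1 + p.2).+1 < q.1 + q.2) || ((q.1 + q.2).+1 < p.1 + p.2).
Proof. rewrite /precedes; lia. Qed.

(** The head of [s1] is moved to the front of [s2]. The cells it passes come before it in [s2] and
    after it in [s1], so they are incomparable to it and their letters commute with its letter. *)
Lemma admissible_perm s1 s2 :
  admissible s1 -> admissible s2 -> perm_eq s1 s2 ->
  word_perm [seq p.1 + p.2 | p <- s1] =1 word_perm [seq p.1 + p.2 | p <- s2].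
Proof.
elim: s1 s2 => [|p s1 IHs] s2 adm1 adm2 eqs x.
  by move: eqs; rewrite perm_sym => /perm_nilP->.
have := perm_mem eqs p; rewrite mem_head => /esym ps2.
case/splitPr: ps2 adm2 eqs => A B adm2 eqs.
move: adm1 => /= /andP[/allP adm1p adm1].
have eqs1 : perm_eq s1 (A ++ B).
  by rewrite -(perm_cons p) (perm_trans eqs) // -cat1s perm_catCA.
move: adm2; rewrite /admissible pairwise_cat allrel_consr -!andbA.
move=> /and4P[/allP admA AB pA /= /andP[_ pB]].
have admAB : admissible (A ++ B) by rewrite /admissible pairwise_cat AB pA pB.
rewrite map_cat /= word_perm_cat !word_perm_cons.
rewrite (IHs _ adm1 admAB eqs1) word_perm_comm.
  by rewrite map_cat word_perm_cat.
apply/allP => _ /mapP[q qA ->]; apply: precedes_letters; first exact: admA.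
by apply: adm1p; rewrite (perm_mem eqs1) mem_cat qA.
Qed.

Lemma admissible_cells D : admissible (cells D).
Proof.
have := cells_uniq D; rewrite uniq_pairwise => neq.
have := cells_sorted D; rewrite (sorted_pairwise reading_le_trans) => le.
have {neq le} := conj le neq; move=> /andP; rewrite -pairwise_relI.
apply: sub_pairwise => -[a b] [c d] /=.
rewrite /reading_le /precedes /= xpair_eqE; lia.
Qed.

Definition swap_cell (p : nat * nat) := (p.2, p.1).

Lemma swap_cellK : involutive swap_cell.
Proof. by case. Qed.

Lemma mem_transpose D p : (p \in transpose D) = (swap_cell p \in D).
Proof.
rewrite -[p in LHS]swap_cellK; apply: (mem_imfset _ _ (inv_inj swap_cellK)).
Qed.

Lemma pairwise_rev (T : Type) (r : rel T) s :
  pairwise r (rev s) = pairwise (fun x y => r y x) s.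
Proof.
elim: s => //= x s IHs.
rewrite rev_cons -cats1 pairwise_cat IHs /= andbT allrel1r all_rev.
by [].
Qed.

Definition lower (D : {fset nat * nat}) := [fset p in D | p.2 < p.1]%fset.

(* Off-diagonal cells above the diagonal may be read first, then the diagonal,
   then the cells below it. *)
Lemma symmetric_reading D (d : seq nat) :
  D = transpose D -> uniq d -> (forall i, (i \in d) = ((i, i) \in D)) ->
  let u := reading_word (lower D) in
  word_perm (reading_word D) =1
    word_perm (rev u ++ [seq i.*2 | i <- d] ++ u) /\
  size (reading_word D) = size d + (size u).*2.
Proof.
move=> symD ud dD u; pose s := cells (lower D).
(* Transposing keeps the sum of the coordinates and reverses the north-east order, so the upper
   cells are the reflected lower cells read backwards. *)
pose t := rev (map swap_cell s) ++ [seq (i, i) | i <- d] ++ s.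
have lets : [seq p.1 + p.2 | p <- t] = rev u ++ [seq i.*2 | i <- d] ++ u.
  rewrite !map_cat map_rev -!map_comp /=; congr (rev _ ++ _ ++ _).
    by rewrite /u reading_wordE; apply: eq_map => p /=; rewrite addnC.
  by apply: eq_map => i /=; rewrite addnn.
have ms p : (p \in s) = (p \in D) && (p.2 < p.1).
  by rewrite mem_cells !inE.
have mrs p : (p \in rev (map swap_cell s)) = (p \in D) && (p.1 < p.2).
  rewrite mem_rev -{1}[p]swap_cellK mem_map; last exact: inv_inj swap_cellK.
  by rewrite ms -mem_transpose -symD.
have md p : (p \in [seq (i, i) | i <- d]) = (p \in D) && (p.1 == p.2).
  apply/mapP/andP => [[i /[!dD] iD ->] //|[pD /eqP eqp]].
  by exists p.1; rewrite ?dD; case: p eqp pD => /= a b ->.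
have adms : pairwise (fun p q => ~~ precedes q p) s := admissible_cells _.
have admt : admissible t.
  rewrite /t /admissible !pairwise_cat allrel_catr pairwise_rev pairwise_map.
  rewrite pairwise_map adms andbT -!andbA; apply/and5P; split.
  - apply/allrelP => -[a b] [a' b']; rewrite mrs md /precedes /=.
    by move=> /andP[_ lt1] /andP[_ lt2]; lia.
  - apply/allrelP => -[a b] [a' b']; rewrite mrs ms /precedes /=.
    by move=> /andP[_ lt1] /andP[_ lt2]; lia.
  - apply: sub_pairwise (admissible_cells (lower D)) => p q /=.
    by rewrite /precedes /= andbC.
  - apply/allrelP => -[a b] [a' b']; rewrite md ms /precedes /=.
    by move=> /andP[_ lt1] /andP[_ lt2]; lia.
  move: ud; rewrite uniq_pairwise; apply: sub_pairwise => i j /=.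
  rewrite /precedes /=; lia.
have permt : perm_eq (cells D) t.
  apply: uniq_perm; first exact: cells_uniq.
    by apply: pairwise_uniq admt => p; rewrite /precedes !leqnn.
  move=> p; rewrite mem_cells !mem_cat mrs md ms.
  by case: (p \in D) => //=; lia.
split=> [x|].
  rewrite -lets reading_wordE.
  by apply: admissible_perm => //; apply: admissible_cells.
rewrite reading_wordE size_map (perm_size permt) -(size_map (fun p => p.1 + p.2)).
by rewrite lets !size_cat size_rev size_map; lia.
Qed.

(** * Truncated involutions and their symmetric words *)

Definition trunc m (z : nat -> nat) x := if x < m then z x else x.

Definition diag_word k := [seq i.*2 | i <- iota 0 k].

Lemma diag_wordE k : word_perm (diag_word k) =1 trunc k.*2 Theta.
Proof.
elim: k => [|k IHk] x //.
rewrite /diag_word -addn1 iotaD map_cat word_perm_cat IHk /= word_perm_cons.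
rewrite /= /trunc /Theta /transp /word_perm /= add0n.
do !case: ifP; do !case: eqP; lia.
Qed.

(** Only the letter [b] lets a strand leave the positions up to [b]; this forces every diagonal
    letter into a word for the truncated [Theta]. *)
Lemma word_perm_notin_le b w x : b \notin w -> x <= b -> word_perm w x <= b.
Proof.
elim: w => // c w IHw; rewrite inE negb_or => /andP[neq /IHw le] /le {IHw le}.
rewrite word_perm_cons /transp; move: (word_perm w x) => y.
by do !case: eqP; lia.
Qed.

Definition eventually_Theta k (z : nat -> nat) :=
  [/\ involutive z, forall x, z x <> x & forall x, k.*2 <= x -> z x = Theta x].

Lemma eventually_Theta_lt k z x :
  eventually_Theta k z -> x < k.*2 -> z x < k.*2.
Proof.
move=> [zK _ zT] ltx; rewrite ltnNge; apply/negP => /[dup] lez /zT.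
by rewrite zK => /esym eqx; have := Theta_lt k (z x); lia.
Qed.

(** Suppose the numbers below an even [i] are matched as in [Theta]. If [z i] exceeds [i.+1], the
    number just before [z i] has a partner greater than [i], which makes it a descent. *)
Lemma no_fdescent z :
  involutive z -> (forall x, z x <> x) -> (forall a, ~ fdescent a z) ->
  z =1 Theta.
Proof.
move=> zK zF nd; elim/ltn_ind => i IHi.
have [oi|ei] := boolP (odd i).
  have eqT : Theta i.-1 = i by rewrite /Theta; case: ifP; lia.
  rewrite -{1}eqT -IHi; last by lia.
  by rewrite zK /Theta oi.
have Ti : Theta i = i.+1 by rewrite /Theta (negPf ei).
have lt_z l : l < i -> z l < i.
  by move=> /[dup] ltl /IHi->; move: ei ltl; rewrite /Theta; case: ifP; lia.
have ziN := zF i; have zzi := zK i.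
have := ltngtP (z i) i.+1; case=> [ltz|gtz|->]; last by rewrite Ti.
  have /lt_z : z i < i by lia.
  by rewrite zK ltnn.
have eqj : (z i).-1.+1 = z i by lia.
have jlt : ~~ (z (z i).-1 < i).
  by apply/negP => /lt_z; rewrite zK; lia.
have jneq : z (z i).-1 <> i by move=> /(congr1 z); rewrite zK; lia.
case: (nd (z i).-1); split; rewrite eqj; first by rewrite zzi; lia.
by move=> /(inv_inj zK); lia.
Qed.

Lemma fdescent_lt k z a :
  eventually_Theta k z -> fdescent a z -> a.+1 < k.*2.
Proof.
move=> zT [lt neq]; rewrite ltnNge; apply/negP => le.
have [_ _ zTh] := zT; have [lea|lta] := leqP k.*2 a.
  move: lt neq; rewrite (zTh a) // (zTh a.+1) ?(leqW lea) //.
  by rewrite /Theta; do !case: ifP; lia.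
have := eventually_Theta_lt zT lta; have := Theta_lt k a.+1.
by rewrite -zTh //; lia.
Qed.

Lemma eventually_Theta_sconj k z a :
  a.+1 < k.*2 -> eventually_Theta k z -> eventually_Theta k (sconj a z).
Proof.
move=> lta [zK zF zT]; rewrite /sconj; split=> x.
- by rewrite transpK zK transpK.
- by move=> /(congr1 (transp a a.+1)); rewrite transpK => /zF.
move=> lex; have tge y : k.*2 <= y -> transp a a.+1 y = y.
  by move=> ley; rewrite /transp; do !case: eqP; lia.
by rewrite tge // zT // tge // leqNgt Theta_lt -leqNgt.
Qed.

(* The length of the permutation drops by two along each conjugation. *)
Lemma short_fword w k z :
  eventually_Theta k z -> word_perm w =1 trunc k.*2 z ->
  exists2 u, fword u z & k + (size u).*2 <= size w.
Proof.
have [N] := ubnP (size w); elim: N w z => // N IHN w z leN zT wz.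
have [zK zF zTh] := zT; have z_inj := inv_inj zK.
have [[a za]|/forallNP nd] := EM (exists a, fdescent a z); last first.
  (* Here [z] is [Theta]: the empty word conjugates, and each of the [k] even letters below [k.*2]
     must occur in [w]. *)
  have zE := no_fdescent zK zF nd; exists [::]; first by move=> x; rewrite zE.
  rewrite addn0 -(size_iota 0 k) -(size_map double).
  apply: uniq_leq_size => [|x /mapP[i]].
    by rewrite map_inj_uniq ?iota_uniq //; apply: double_inj.
  rewrite mem_iota add0n => /= ltik ->; apply/negPn/negP => /word_perm_notin_le.
  move=> /(_ _ (leqnn _)); rewrite wz /trunc ltn_double ltik zE /Theta odd_double.
  by rewrite ltnn.
have lta := fdescent_lt zT za; have ltz := eventually_Theta_lt zT.
have [ltza zaN] := za.
(* The first deletion removes a crossing of [a] and [a.+1], the second one of their partners, which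
   the first transposition fixes. *)
have [||i lti w'] := @exchange w a a.+1 => //.
  by rewrite !wz /trunc lta (ltnW lta).
have ltza1 : z a.+1 < k.*2 by apply: ltz.
have ltza0 : z a < k.*2 by apply: ltz; lia.
have za1 : z a.+1 <> a by move=> /(congr1 z); rewrite zK => /esym.
have sfix y : y <> a -> y <> a.+1 -> transp a a.+1 y = y.
  by rewrite /transp; do !case: eqP.
have [||j ltj w''] := @exchange (take i w ++ drop i.+1 w) (z a.+1) (z a) => //.
  rewrite !w' /= !wz !sfix //.
  by rewrite /trunc ltza1 ltza0 !zK.
set w2 := take j _ ++ _ in w''.
have eqsz : size w = (size w2).+2 by rewrite (size_delete lti) (size_delete ltj).
have w2E : word_perm w2 =1 trunc k.*2 (sconj a z).
  move=> x; rewrite w'' /= w' /= wz /trunc.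
  have tlt b c y : b < k.*2 -> c < k.*2 -> (transp b c y < k.*2) = (y < k.*2).
    by move=> ltb ltc; rewrite /transp; do !case: eqP => //; lia.
  rewrite !tlt //; last by lia.
  case: ltnP => [ltx|lex].
    by rewrite -(sconj_transp zK zF zaN).
  by rewrite /transp; do !case: eqP => //; lia.
have [|u uz leu] := IHN w2 _ _ (eventually_Theta_sconj lta zT) w2E.
  by lia.
exists (rcons u a); last by rewrite size_rcons; lia.
by apply: fword_ext (@sconjK a z) _; apply: fword_sconj.
Qed.

(** Each pair of [Theta] beyond [k.*2] is an inversion that exchange cancels by erasing one letter;
    this compares words truncated at different bounds. *)
Lemma trunc_word w k j z :
  (forall x, k.*2 <= x -> z x = Theta x) ->
  word_perm w =1 trunc (k + j).*2 z ->
  exists2 w', word_perm w' =1 trunc k.*2 z & size w' + j = size w.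
Proof.
move=> zT; elim: j w => [|j IHj] w wz.
  by exists w; rewrite ?addn0 // in wz *.
set a := (k + j).*2.
have za : z a = a.+1 by rewrite zT /Theta ?odd_double // leq_double leq_addr.
have za1 : z a.+1 = a by rewrite zT /Theta /= ?odd_double //; lia.
have [||i lti w'] := @exchange w a a.+1 => //.
  rewrite !wz /trunc /a !ifT; [|lia|lia].
  by rewrite -/a za za1.
have [x|w2 w2z eqs] := IHj (take i w ++ drop i.+1 w).
  rewrite w' /= wz /trunc -/a /transp addnS doubleS -/a.
  have [->|] := eqVneq x a; first by rewrite /= ltnSn ltnn za1.
  have [->|] := eqVneq x a.+1; first by rewrite /= za ltnS leqnSn ltnNge leqnSn.
  move=> ne1 ne2; have -> : (x < a.+2) = (x < a) by lia.
  by [].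
by exists w2 => //; rewrite addnS eqs -(size_delete lti).
Qed.

(** On the numbers below [k.*2], which [u] preserves, this is the conjugation defining [fword];
    beyond them all three factors are trivial. *)
Lemma fword_trunc u z k :
  fword u z -> all (fun b => b.+1 < k.*2) u ->
  word_perm (rev u ++ diag_word k ++ u) =1 trunc k.*2 z.
Proof.
move=> uz allu x; rewrite !word_perm_cat diag_wordE /trunc.
have [ltx|lex] := ltnP x k.*2.
  by rewrite (word_perm_lt allu ltx) -uz word_perm_revK.
rewrite (word_perm_ge allu lex) ltnNge lex /=.
by rewrite (@word_perm_ge k.*2) // all_rev.
Qed.

Lemma letters_bounded w : exists k, all (fun b => b.+1 < k.*2) w.
Proof.
exists (sumn w).+1; elim: w => //= b w IHw; apply/andP; split; first by lia.
by apply: sub_all IHw => c /=; lia.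
Qed.

Lemma fword_eventually_Theta u z k :
  fword u z -> all (fun b => b.+1 < k.*2) u -> eventually_Theta k z.
Proof.
move=> uz allu; split; [exact: fword_invol uz|exact: fword_fpf uz|].
move=> x lex; apply: (@word_perm_inj u).
by rewrite uz !(word_perm_ge allu) // leqNgt Theta_lt -leqNgt.
Qed.

(** * The elements of [FP z] as minimal words *)

Lemma perm_nat_ord n (y : 'S_n) (i : 'I_n) : perm_nat y i = y i.
Proof. by rewrite /perm_nat valK. Qed.

Lemma perm_nat_ge n (y : 'S_n) x : n <= x -> perm_nat y x = x.
Proof. by move=> lex; rewrite /perm_nat insubF // ltnNge lex. Qed.

Lemma mem_lower D p : (p \in lower D) = (p \in D) && (p.2 < p.1).
Proof. by rewrite !inE. Qed.

Lemma all_reading_word (P : pred nat) D :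
  reflect {in D, forall p, P (p.1 + p.2)} (all P (reading_word D)).
Proof.
apply: (iffP allP) => [PD p pD|PD _ /mapP[p pD ->]].
  by apply: PD; apply/mapP; exists p; rewrite ?mem_cells.
by apply: PD; rewrite -mem_cells.
Qed.

(* A strand through an uncrossed diagonal cell is its own mirror image, so it
   is a fixed point of the symmetric permutation. *)
Lemma symmetric_diag k D f :
  D = transpose D -> word_perm (reading_word D) =1 f ->
  all (fun b => b.+1 < k.*2) (reading_word D) ->
  (forall x, x < k.*2 -> f x <> x) ->
  forall i, ((i, i) \in D) = (i < k).
Proof.
move=> symD wD /all_reading_word letD f_fpf i; apply/idP/idP => [/letD /=|ltik].
  by lia.
pose d := [seq p.1 | p <- enum_fset [fset p in D | p.1 == p.2]%fset].
have dD j : (j \in d) = ((j, j) \in D).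
  apply/mapP/idP => [[[a b]]|jD].
    by rewrite !inE /= => /andP[abD /eqP eqab] ->; rewrite {2}eqab.
  by exists (j, j) => //; rewrite !inE jD /=.
have ud : uniq d.
  rewrite map_inj_in_uniq ?fset_uniq // => -[a b] [a' b'].
  by rewrite !inE /= => /andP[_ /eqP<-] /andP[_ /eqP<-] ->.
have [wE _] := symmetric_reading symD ud dD; set u := reading_word (lower D) in wE.
apply/negPn/negP => iD; pose x := word_perm (rev u) i.*2.
apply: (f_fpf x).
  apply: word_perm_lt; last by rewrite ltn_double.
  rewrite all_rev; apply/all_reading_word => p.
  by rewrite mem_lower => /andP[/letD].
rewrite -wD wE !word_perm_cat word_permK [word_perm (map _ _) _]word_perm_fix //.
apply/allP => _ /mapP[j jd ->].
have : i != j by apply: contraNneq iD => ->; rewrite -dD.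
by lia.
Qed.

(** Symmetry and the full diagonal make [y] the product of [rev u], the diagonal and [u], so [u]
    conjugates [Theta] to [z]; a shorter conjugating word would give a shorter word for [y]. *)
Lemma FP_reduced z E : FP z E -> reduced_fword (reading_word E) z.
Proof.
move=> [m [y [D [evm [_ y_fpf] zE [symD [wD minD]] EE]]]].
have {EE} -> : E = lower D by [].
set u := reading_word _; pose k := m./2.
have mk : k.*2 = m := even_halfK evm.
have letD := reduced_letters (conj wD minD) (@perm_nat_ge _ y).
have letu : all (fun b => b.+1 < m) u.
  apply/all_reading_word => p; rewrite mem_lower => /andP[pD _].
  by move/all_reading_word: letD => /(_ _ pD).
have f_fpf x : x < k.*2 -> perm_nat y x <> x.
  rewrite mk => ltx; rewrite -[x in perm_nat y x]/(val (Ordinal ltx)).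
  rewrite perm_nat_ord => eqx; have /eqP[] := y_fpf (Ordinal ltx).
  exact: val_inj.
have diagD : forall i, (i \in iota 0 k) = ((i, i) \in D).
  by move=> i; rewrite mem_iota (symmetric_diag symD wD _ f_fpf) // mk.
have [wE szD] := symmetric_reading symD (iota_uniq 0 k) diagD.
rewrite -/u size_iota in wE szD.
have uz : fword u z.
  move=> x; rewrite zE /= -[m in tail_swaps m]mk tail_swapsE.
  case: ltnP => [ltx|lex].
    rewrite -wD wE !word_perm_cat word_permK diag_wordE /trunc.
    by rewrite word_perm_lt // mk.
  have leT : m <= Theta x by rewrite -mk leqNgt Theta_lt -leqNgt.
  by rewrite perm_nat_ge // !(word_perm_ge letu) // -mk.
rewrite -mk in letu; have [zK zF zT] := fword_eventually_Theta uz letu.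
(* A competitor [u'] may use letters beyond [m]. Its symmetric word has [k + j] diagonal letters and
   loses [j] letters when cut back to the numbers below [m]. *)
split=> // u' u'z; have [j letu'] := letters_bounded u'.
have lekj : j <= k + j by rewrite leq_addl.
have {}letu' : all (fun b => b.+1 < (k + j).*2) u'.
  by apply: sub_all letu' => b /= ltb; lia.
have [w' w'z eqs] := trunc_word zT (fword_trunc u'z letu').
suff /minD : word_perm w' =1 perm_nat y.
  move: eqs; rewrite szD !size_cat size_rev size_map size_iota; lia.
move=> x; rewrite w'z -wD wE; apply/esym.
exact: fword_trunc.
Qed.

(** The pipe dream is [E], its reflection and [k] diagonal cells, with [k] large enough for all
    letters of [E]. It is reduced because [short_fword] turns any word for [y] into a conjugating
    word, which is no shorter than [u]. *)
Lemma reduced_FP z E :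
  {in E, forall p, p.2 < p.1} -> reduced_fword (reading_word E) z -> FP z E.
Proof.
move=> lowE [uz umin]; set u := reading_word E in uz umin.
have [k letu] := letters_bounded u.
have zT := fword_eventually_Theta uz letu; have [zK zF zTh] := zT.
pose D := (E `|` transpose E `|` [fset (i, i) | i in iota 0 k])%fset.
have memD p : (p \in D) =
    [|| p \in E, swap_cell p \in E | (p.1 == p.2) && (p.1 < k)].
  rewrite !in_fsetU mem_transpose -orbA; congr [|| _, _ | _].
  apply/imfsetP/andP => [[i /=]|[/eqP eqp ltp]].
    by rewrite mem_iota => /= ltik -> /=.
  exists p.1; rewrite /= ?mem_iota //.
  by case: p eqp {ltp} => a b /= ->.
have symD : D = transpose D.
  apply/fsetP => p; rewrite mem_transpose !memD swap_cellK /= orbCA.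
  by congr [|| _, _ | _]; case: eqP => [->|]; case: eqP => // ->.
have lowD : lower D = E.
  apply/fsetP => p; rewrite mem_lower memD; apply/andP/idP => [[]|pE].
    by case/or3P => // [/lowE /=|]; lia.
  by rewrite pE lowE.
have diagD i : (i \in iota 0 k) = ((i, i) \in D).
  rewrite mem_iota memD /= eqxx /=.
  by case: (boolP ((i, i) \in E)) => // /lowE; rewrite ltnn.
have [wE szD] := symmetric_reading symD (iota_uniq 0 k) diagD.
rewrite lowD -/u size_iota in wE szD.
have y_inj : injective (fun i : 'I_k.*2 =>
    Ordinal (eventually_Theta_lt zT (ltn_ord i))).
  by move=> i j /(congr1 val) /= /(inv_inj zK) /val_inj.
pose y := perm y_inj.
have yE : perm_nat y =1 trunc k.*2 z.
  move=> x; rewrite /trunc; case: ltnP => [ltx|]; last exact: perm_nat_ge.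
  by rewrite -[x in LHS]/(val (Ordinal ltx)) perm_nat_ord permE.
exists k.*2, y, D; split.
- by rewrite odd_double.
- split=> [|i]; last by rewrite permE -val_eqE /=; apply/eqP/zF.
  rewrite inE; apply/eqP/permP => i; apply: val_inj.
  by rewrite expgS expg1 permM perm1 !permE /= zK.
- move=> x; rewrite /= yE tail_swapsE /trunc; case: (ltnP x) => [ltx|lex].
    by rewrite ltx.
  by rewrite Theta_lt ltnNge lex /= zTh.
- split=> //; split=> [x|w' w'y].
    by rewrite wE yE; apply: fword_trunc.
  have [|u' /umin leu le] := @short_fword w' k z zT.
    by move=> x; rewrite w'y yE.
  by rewrite szD; lia.
by rewrite -lowD.
Qed.

Lemma Sigma_subword z Q :
  {in Q, forall p, p.2 < p.1} -> subword_complex z Q (Sigma z Q).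
Proof.
move=> lowQ; split=> // S; rewrite /= /Sigma_faces !inE /= fpowersetE.
split=> [/andP[SQ /asboolP[E zE EQS]]|[SQ [E Ez EQS]]].
  by split=> //; exists E => //; apply: FP_reduced.
rewrite SQ; apply/asboolP; exists E => //; apply: reduced_FP => // p pE.
by apply: lowQ; have := fsubsetP EQS p pE; rewrite in_fsetD => /andP[].
Qed.

Theorem theorem4p25 (n : nat) (z : nat -> nat) (Q : {fset nat * nat})
  (n_gt0 : 0 < n)
  (z_FPF : in_FPF_image n z)
  (Q_lower : forall p : nat * nat, p \in Q -> [&& p.1 < n, p.2 < n & p.2 < p.1]) :
  vertex_decomposable (Sigma z Q) /\ shellable (Sigma z Q).
Proof.
have vd : vertex_decomposable (Sigma z Q).
  apply: (@subword_complex_vd z Q); apply: Sigma_subword => p.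
  by move=> /Q_lower/and3P[].
by split=> //; apply: vertex_decomposable_shellable.
Qed.
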